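(* A symmetric monoidal category $C$ is equivalent, as an object of the 2-category $\mathrm{SymmMonCat}$, to a prop if and only if there is an object $x \in C$ such that every object of $C$ is isomorphic to the $n$th tensor power $x^{\otimes n} = x \otimes (x \otimes (x \otimes \cdots))$ of $x$ for some $n \in \mathbb{N}$.
   Context: A prop is a strict symmetric monoidal category having the natural numbers as objects, with the tensor product of objects given by addition. $\mathrm{SymmMonCat}$ is the 2-category whose objects are (not necessarily strict) symmetric monoidal categories, whose morphisms are symmetric monoidal functors (in the ''weak'' sense, called ''strong'' by Mac Lane: the tensor product and unit are preserved up to coherent natural isomorphism), and whose 2-morphisms are monoidal natural transformations. Thus $C$ is equivalent to a prop $T$ in $\mathrm{SymmMonCat}$ if there are symmetric monoidal functors $j\colon T \to C$ and $k \colon C \to T$ together with monoidal natural isomorphisms $jk \cong 1_C$ and $kj \cong 1_T$. *)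

(* Defs.v *)
From Corelib Require Import ssreflect.

Set Implicit Arguments.
Unset Strict Implicit.
Unset Printing Implicit Defensive.

Declare Scope cat_scope.
Delimit Scope cat_scope with cat.
Local Open Scope cat_scope.

(* Structures are indexed by their type of objects, so that a prop can have
   literally [nat] as its objects. *)
Record category (O : Type) := Category {
  hom : O -> O -> Type;
  idm : forall a, hom a a;
  comp : forall a b c, hom b c -> hom a b -> hom a c;
  comp_idl : forall a b (f : hom a b), comp (idm b) f = f;
  comp_idr : forall a b (f : hom a b), comp f (idm a) = f;
  compA : forall a b c d (h : hom c d) (g : hom b c) (f : hom a b),
    comp h (comp g f) = comp (comp h g) f
}.

Arguments idm {O} _ a.

Notation "g ∘ f" := (comp g f) (at level 40, left associativity) : cat_scope.

Definition is_iso O (C : category O) a b (f : hom C a b) : Prop :=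
  exists g : hom C b a, g ∘ f = idm C a /\ f ∘ g = idm C b.

Definition isomorphic O (C : category O) (a b : O) : Prop :=
  exists f : hom C a b, is_iso f.

(* Invertibility of the braiding follows from [braidK]. *)
Record symmetric_monoidal O (C : category O) := SymmetricMonoidal {
  tens : O -> O -> O;
  tensm : forall a b c d, hom C a b -> hom C c d -> hom C (tens a c) (tens b d);
  tensm_id : forall a b, tensm (idm C a) (idm C b) = idm C (tens a b);
  tensm_comp : forall a b c a' b' c'
      (g : hom C b c) (f : hom C a b) (g' : hom C b' c') (f' : hom C a' b'),
    tensm (g ∘ f) (g' ∘ f') = tensm g g' ∘ tensm f f';
  tunit : O;

  assoc : forall a b c, hom C (tens (tens a b) c) (tens a (tens b c));
  lunit : forall a, hom C (tens tunit a) a;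
  runit : forall a, hom C (tens a tunit) a;
  braid : forall a b, hom C (tens a b) (tens b a);
  assoc_iso : forall a b c, is_iso (assoc a b c);
  lunit_iso : forall a, is_iso (lunit a);
  runit_iso : forall a, is_iso (runit a);
  assoc_natural : forall a b c a' b' c'
      (f : hom C a a') (g : hom C b b') (h : hom C c c'),
    assoc a' b' c' ∘ tensm (tensm f g) h = tensm f (tensm g h) ∘ assoc a b c;
  lunit_natural : forall a b (f : hom C a b),
    lunit b ∘ tensm (idm C tunit) f = f ∘ lunit a;
  runit_natural : forall a b (f : hom C a b),
    runit b ∘ tensm f (idm C tunit) = f ∘ runit a;
  braid_natural : forall a b a' b' (f : hom C a a') (g : hom C b b'),
    braid a' b' ∘ tensm f g = tensm g f ∘ braid a b;

  pentagon : forall a b c d,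
    assoc a b (tens c d) ∘ assoc (tens a b) c d =
    tensm (idm C a) (assoc b c d) ∘ assoc a (tens b c) d
      ∘ tensm (assoc a b c) (idm C d);
  triangle : forall a b,
    tensm (idm C a) (lunit b) ∘ assoc a tunit b = tensm (runit a) (idm C b);
  hexagon : forall a b c,
    assoc b c a ∘ braid a (tens b c) ∘ assoc a b c =
    tensm (idm C b) (braid a c) ∘ assoc b a c ∘ tensm (braid a b) (idm C c);
  braidK : forall a b, braid b a ∘ braid a b = idm C (tens a b)
}.

Record symmMonCat := SymmMonCat {
  obj :> Type;
  cat_of : category obj;
  smon_of : symmetric_monoidal cat_of
}.

Notation Hom := (hom (cat_of _)).
Notation Id := (idm (cat_of _)).
Notation "a ⊗ b" := (tens (smon_of _) a b)
  (at level 35, right associativity) : cat_scope.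
Notation "f ⊠ g" := (tensm (smon_of _) f g)
  (at level 35, right associativity) : cat_scope.
Notation munit C := (tunit (smon_of C)).
Notation α := (assoc (smon_of _)).
Notation λ_ := (lunit (smon_of _)).
Notation ρ_ := (runit (smon_of _)).
Notation β := (braid (smon_of _)).

Fixpoint tpow (C : symmMonCat) (x : C) (n : nat) : C :=
  match n with
  | 0 => munit C
  | 1 => x
  | S m => x ⊗ tpow x m
  end.

Definition eq_hom O (C : category O) a b (e : a = b) : hom C a b :=
  match e in _ = b return hom C a b with eq_refl => idm C a end.

(* The braiding of a strict symmetric monoidal category need not be an
   identity. *)
Definition strict (C : symmMonCat) : Prop :=
  (forall a b c : C, exists e : (a ⊗ b) ⊗ c = a ⊗ (b ⊗ c),
     α a b c = eq_hom (cat_of C) e) /\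
  (forall a : C, exists e : munit C ⊗ a = a, λ_ a = eq_hom (cat_of C) e) /\
  (forall a : C, exists e : a ⊗ munit C = a, ρ_ a = eq_hom (cat_of C) e).

(* The unit object is 0: by strictness it is neutral for addition. *)
Record prop := MkProp {
  prop_cat : category nat;
  prop_smon : symmetric_monoidal prop_cat;
  prop_strict : strict (SymmMonCat prop_smon);
  prop_tens : forall m n : nat, tens prop_smon m n = m + n
}.

Coercion symmMonCat_of_prop (T : prop) : symmMonCat :=
  SymmMonCat (prop_smon T).

Record symmMonFunctor (C D : symmMonCat) := SymmMonFunctor {
  fobj :> C -> D;
  fmap : forall a b : C, Hom a b -> Hom (fobj a) (fobj b);
  fmap_id : forall a : C, fmap (Id a) = Id (fobj a);
  fmap_comp : forall (a b c : C) (g : Hom b c) (f : Hom a b),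
    fmap (g ∘ f) = fmap g ∘ fmap f;

  fmu : forall a b : C, Hom (fobj a ⊗ fobj b) (fobj (a ⊗ b));
  feta : Hom (munit D) (fobj (munit C));
  fmu_iso : forall a b : C, is_iso (fmu a b);
  feta_iso : is_iso feta;
  fmu_natural : forall (a b a' b' : C) (f : Hom a a') (g : Hom b b'),
    fmu a' b' ∘ (fmap f ⊠ fmap g) = fmap (f ⊠ g) ∘ fmu a b;
  fmu_assoc : forall a b c : C,
    fmap (α a b c) ∘ fmu (a ⊗ b) c ∘ (fmu a b ⊠ Id (fobj c)) =
    fmu a (b ⊗ c) ∘ (Id (fobj a) ⊠ fmu b c) ∘ α (fobj a) (fobj b) (fobj c);
  fmu_lunit : forall a : C,
    fmap (λ_ a) ∘ fmu (munit C) a ∘ (feta ⊠ Id (fobj a)) = λ_ (fobj a);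
  fmu_runit : forall a : C,
    fmap (ρ_ a) ∘ fmu a (munit C) ∘ (Id (fobj a) ⊠ feta) = ρ_ (fobj a);
  fmu_braid : forall a b : C,
    fmap (β a b) ∘ fmu a b = fmu b a ∘ β (fobj a) (fobj b)
}.

Record monoidalNatTrans (C D : symmMonCat) (F G : symmMonFunctor C D) :=
  MonoidalNatTrans {
  ntapp :> forall a : C, Hom (F a) (G a);
  nt_natural : forall (a b : C) (f : Hom a b),
    ntapp b ∘ fmap F f = fmap G f ∘ ntapp a;
  nt_mu : forall a b : C,
    ntapp (a ⊗ b) ∘ fmu F a b = fmu G a b ∘ (ntapp a ⊠ ntapp b);
  nt_eta : ntapp (munit C) ∘ feta F = feta G
}.

Definition monoidally_isomorphic (C D : symmMonCat)
    (F G : symmMonFunctor C D) : Prop :=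
  exists θ : monoidalNatTrans F G, forall a : C, is_iso (θ a).

Lemma is_iso_id O (C : category O) a : is_iso (idm C a).
Proof. by exists (idm C a); rewrite comp_idl. Qed.

Lemma is_iso_comp O (C : category O) a b c (g : hom C b c) (f : hom C a b) :
  is_iso g -> is_iso f -> is_iso (g ∘ f).
Proof.
move=> [g' [gK Kg]] [f' [fK Kf]]; exists (f' ∘ g'); split.
- by rewrite compA -(compA f') gK comp_idr.
- by rewrite compA -(compA g) Kf comp_idr.
Qed.

Lemma is_iso_fmap (C D : symmMonCat) (F : symmMonFunctor C D) (a b : C)
  (f : Hom a b) : is_iso f -> is_iso (fmap F f).
Proof.
move=> [g [fK Kf]]; exists (fmap F g).
by rewrite -!fmap_comp fK Kf !fmap_id.
Qed.

#[local] Obligation Tactic := intros; simpl.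

Program Definition functor_id (C : symmMonCat) : symmMonFunctor C C :=
  {| fobj := fun a => a;
     fmap := fun a b f => f;
     fmu := fun a b => Id (a ⊗ b);
     feta := Id (munit C) |}.
Next Obligation. done. Qed.
Next Obligation. done. Qed.
Next Obligation. exact: is_iso_id. Qed.
Next Obligation. exact: is_iso_id. Qed.
Next Obligation. by rewrite comp_idl comp_idr. Qed.
Next Obligation. by rewrite !tensm_id !comp_idl !comp_idr. Qed.
Next Obligation. by rewrite !tensm_id !comp_idr. Qed.
Next Obligation. by rewrite !tensm_id !comp_idr. Qed.
Next Obligation. by rewrite comp_idl comp_idr. Qed.

Section Composition.
Variables (C D E : symmMonCat).
Variables (G : symmMonFunctor D E) (F : symmMonFunctor C D).

Let mu (a b : C) : Hom (G (F a) ⊗ G (F b)) (G (F (a ⊗ b))) :=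
  fmap G (fmu F a b) ∘ fmu G (F a) (F b).
Let eta : Hom (munit E) (G (F (munit C))) := fmap G (feta F) ∘ feta G.

Let tensm_compl (a b c d : E) (g : Hom b c) (f : Hom a b) :
  (g ∘ f) ⊠ Id d = (g ⊠ Id d) ∘ (f ⊠ Id d).
Proof. by rewrite -tensm_comp comp_idl. Qed.

Let tensm_compr (a b c d : E) (g : Hom b c) (f : Hom a b) :
  Id d ⊠ (g ∘ f) = (Id d ⊠ g) ∘ (Id d ⊠ f).
Proof. by rewrite -tensm_comp comp_idl. Qed.

Let mu_naturall (a b c : D) (f : Hom a b) :
  fmu G b c ∘ (fmap G f ⊠ Id (G c)) = fmap G (f ⊠ Id c) ∘ fmu G a c.
Proof. by rewrite -fmu_natural fmap_id. Qed.

Let mu_naturalr (a b c : D) (f : Hom a b) :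
  fmu G c b ∘ (Id (G c) ⊠ fmap G f) = fmap G (Id c ⊠ f) ∘ fmu G c a.
Proof. by rewrite -fmu_natural fmap_id. Qed.

Lemma functor_comp_mu_assoc (a b c : C) :
  fmap G (fmap F (α a b c)) ∘ mu (a ⊗ b) c ∘ (mu a b ⊠ Id (G (F c))) =
  mu a (b ⊗ c) ∘ (Id (G (F a)) ⊠ mu b c) ∘ α (G (F a)) (G (F b)) (G (F c)).
Proof.
rewrite /mu tensm_compl tensm_compr !compA.
rewrite -!(compA _ (fmu G _ _) (fmap G _ ⊠ _)) mu_naturall.
rewrite -!(compA _ (fmu G _ _) (_ ⊠ fmap G _)) mu_naturalr.
rewrite !compA -!fmap_comp fmu_assoc !fmap_comp.
by rewrite -!compA; do 2 congr comp; rewrite !compA fmu_assoc.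
Qed.

Lemma functor_comp_mu_lunit (a : C) :
  fmap G (fmap F (λ_ a)) ∘ mu (munit C) a ∘ (eta ⊠ Id (G (F a))) = λ_ (G (F a)).
Proof.
rewrite /mu /eta tensm_compl !compA.
rewrite -!(compA _ (fmu G _ _) (fmap G _ ⊠ _)) mu_naturall.
by rewrite !compA -!fmap_comp fmu_lunit fmu_lunit.
Qed.

Lemma functor_comp_mu_runit (a : C) :
  fmap G (fmap F (ρ_ a)) ∘ mu a (munit C) ∘ (Id (G (F a)) ⊠ eta) = ρ_ (G (F a)).
Proof.
rewrite /mu /eta tensm_compr !compA.
rewrite -!(compA _ (fmu G _ _) (_ ⊠ fmap G _)) mu_naturalr.
by rewrite !compA -!fmap_comp fmu_runit fmu_runit.
Qed.

Program Definition functor_comp : symmMonFunctor C E :=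
  {| fobj := fun a => G (F a);
     fmap := fun a b f => fmap G (fmap F f);
     fmu := fun a b => fmap G (fmu F a b) ∘ fmu G (F a) (F b);
     feta := fmap G (feta F) ∘ feta G |}.
Next Obligation. by rewrite !fmap_id. Qed.
Next Obligation. by rewrite !fmap_comp. Qed.
Next Obligation.
apply: is_iso_comp; last exact: fmu_iso.
by apply: is_iso_fmap; exact: fmu_iso.
Qed.
Next Obligation.
apply: is_iso_comp; last exact: feta_iso.
by apply: is_iso_fmap; exact: feta_iso.
Qed.
Next Obligation.
by rewrite -compA fmu_natural !compA -!fmap_comp fmu_natural.
Qed.
Next Obligation. exact: functor_comp_mu_assoc. Qed.
Next Obligation. exact: functor_comp_mu_lunit. Qed.
Next Obligation. exact: functor_comp_mu_runit. Qed.
Next Obligation.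
by rewrite compA -fmap_comp fmu_braid fmap_comp -!compA fmu_braid.
Qed.

End Composition.

Definition symmMon_equivalent (C D : symmMonCat) : Prop :=
  exists (j : symmMonFunctor D C) (k : symmMonFunctor C D),
    monoidally_isomorphic (functor_comp j k) (functor_id C) /\
    monoidally_isomorphic (functor_comp k j) (functor_id D).

(* Main.v *)
From Corelib Require Import ssreflect ssrfun.
From Stdlib Require Import IndefiniteDescription Lia.
Require Import Defs.

(** Suppose that every object of [C] is isomorphic to a tensor power of [x], and
    write [P n] for the power [x ⊗ (x ⊗ (... ⊗ munit C))]. Take as arrows from
    [m] to [n] the arrows of [C] from [P m] to [P n]. The evident isomorphisms
    [P m ⊗ P n ≅ P (m + n)] carry the whole symmetric monoidal structure of [C]
    over to this category on the natural numbers ([transported]), and the axioms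
    hold because they hold in [C]. What has to be seen is that the result is a
    prop, that is, that the transported associator and unitors are identities
    ([upow_strict]). For the associator this amounts to saying that the canonical
    isomorphism [(P m ⊗ P n) ⊗ P p ≅ P (m + n + p)] does not depend on the
    bracketing, which is an induction on [m]: the pentagon gives the inductive
    step, and Kelly's consequences of the pentagon and triangle axioms
    ([lunit_tens], [runit_tens], [lunit_runit_unit]) handle the units.

    The inclusion of this prop in [C] is fully faithful, and it is essentially
    surjective by the choice of [x]. Such a symmetric monoidal functor is an
    equivalence in the 2-category of symmetric monoidal categories
    ([equivalence_of_ff_esurj]): choose an isomorphism from an object in the
    image to each object of [C], and let these isomorphisms determine the
    inverse functor together with its monoidal structure.

    Conversely, in a prop the object [n] is the [n]th tensor power of [1]; an
    equivalence [j] from a prop to [C] preserves tensor powers up to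
    isomorphism, so the powers of [j 1] exhaust [C] up to isomorphism. *)

Set Implicit Arguments.
Unset Strict Implicit.
Unset Printing Implicit Defensive.

Local Open Scope cat_scope.

(** * Isomorphisms *)

Section Isomorphisms.
Variables (O : Type) (C : category O).

Lemma is_iso_epi (a b c : O) (e : hom C a b) (f g : hom C b c) :
  is_iso e -> f ∘ e = g ∘ e -> f = g.
Proof.
move=> [e' [_ eK]] /(f_equal (fun h => h ∘ e')).
by rewrite -!compA eK !comp_idr.
Qed.

Lemma is_iso_mono (a b c : O) (e : hom C b c) (f g : hom C a b) :
  is_iso e -> e ∘ f = e ∘ g -> f = g.
Proof.
move=> [e' [eK _]] /(f_equal (fun h => e' ∘ h)).
by rewrite !compA eK !comp_idl.
Qed.

Lemma is_iso_eq_hom (a b : O) (e : a = b) : is_iso (eq_hom C e).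
Proof. by case: b / e; exact: is_iso_id. Qed.

Lemma isomorphic_sym (a b : O) : isomorphic C a b -> isomorphic C b a.
Proof. by move=> [f [g [fK gK]]]; exists g, f. Qed.

Lemma isomorphic_trans (a b c : O) :
  isomorphic C a b -> isomorphic C b c -> isomorphic C a c.
Proof.
by move=> [f f_iso] [g g_iso]; exists (g ∘ f); exact: is_iso_comp.
Qed.

Lemma eq_isomorphic (a b : O) : a = b -> isomorphic C a b.
Proof. by move=> e; exists (eq_hom C e); exact: is_iso_eq_hom. Qed.

Lemma descend_subproof (a b c : O) (e : hom C a b) (g : hom C a c) :
  is_iso e -> exists h : hom C b c, h ∘ e = g.
Proof.
by move=> [e' [eK _]]; exists (g ∘ e'); rewrite -compA eK comp_idr.
Qed.

(** The composite of [g] with the inverse of [e], chosen through its defining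
    equation so that rewriting with associativity cannot unfold it. *)
Definition descend (a b c : O) (e : hom C a b) (e_iso : is_iso e)
    (g : hom C a c) : hom C b c :=
  proj1_sig
    (constructive_indefinite_description _ (descend_subproof g e_iso)).

Lemma descendK (a b c : O) (e : hom C a b) (e_iso : is_iso e) (g : hom C a c) :
  descend e_iso g ∘ e = g.
Proof. by rewrite /descend; case: constructive_indefinite_description. Qed.

Lemma is_iso_descend (a b c : O) (e : hom C a b) (e_iso : is_iso e)
    (g : hom C a c) :
  is_iso g -> is_iso (descend e_iso g).
Proof.
move=> [g' [gK Kg]]; exists (e ∘ g'); split; last by rewrite compA descendK.
by apply: (is_iso_epi e_iso); rewrite -!compA descendK gK comp_idl comp_idr.
Qed.

(** Composites are kept associated to the right; this turns a commuting square
    into a rewriting rule that also applies in front of a further arrow. *)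
Lemma comp_square (a b b' c z : O) (g : hom C b c) (f : hom C a b)
    (g' : hom C b' c) (f' : hom C a b') :
  g ∘ f = g' ∘ f' -> forall t : hom C z a, g ∘ (f ∘ t) = g' ∘ (f' ∘ t).
Proof. by move=> E t; rewrite !compA E. Qed.

Lemma comp_triangle (a b c z : O) (g : hom C b c) (f : hom C a b)
    (h : hom C a c) :
  g ∘ f = h -> forall t : hom C z a, g ∘ (f ∘ t) = h ∘ t.
Proof. by move=> E t; rewrite !compA E. Qed.

End Isomorphisms.

(** * Coherence of the unit *)

Section UnitCoherence.
Variable C : symmMonCat.
Implicit Types a b c d : C.

Lemma tensm_compl a b c d (g : Hom b c) (f : Hom a b) :
  (g ∘ f) ⊠ Id d = (g ⊠ Id d) ∘ (f ⊠ Id d).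
Proof. by rewrite -tensm_comp comp_idl. Qed.

Lemma tensm_compr a b c d (g : Hom b c) (f : Hom a b) :
  Id d ⊠ (g ∘ f) = (Id d ⊠ g) ∘ (Id d ⊠ f).
Proof. by rewrite -tensm_comp comp_idl. Qed.

Lemma tensm_fuse a b c a' b' c' z (g : Hom b c) (f : Hom a b)
    (g' : Hom b' c') (f' : Hom a' b') (t : Hom z (a ⊗ a')) :
  (g ⊠ g') ∘ ((f ⊠ f') ∘ t) = ((g ∘ f) ⊠ (g' ∘ f')) ∘ t.
Proof. by rewrite compA tensm_comp. Qed.

Lemma is_iso_tensm a b c d (f : Hom a b) (g : Hom c d) :
  is_iso f -> is_iso g -> is_iso (f ⊠ g).
Proof.
move=> [f' [fK Kf]] [g' [gK Kg]]; exists (f' ⊠ g').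
by rewrite -!tensm_comp fK Kf gK Kg !tensm_id.
Qed.

Lemma isomorphic_tens a b c d :
  isomorphic (cat_of C) a b -> isomorphic (cat_of C) c d ->
  isomorphic (cat_of C) (a ⊗ c) (b ⊗ d).
Proof.
by move=> [f f_iso] [g g_iso]; exists (f ⊠ g); exact: is_iso_tensm.
Qed.

(** The left unitor makes tensoring with the unit isomorphic to the identity
    functor, hence faithful. *)
Lemma tensm_unitl_inj a b (f g : Hom a b) :
  Id (munit C) ⊠ f = Id (munit C) ⊠ g -> f = g.
Proof.
move=> E; apply: (is_iso_epi (lunit_iso (smon_of C) a)).
by rewrite -!lunit_natural E.
Qed.

Lemma tensm_unitr_inj a b (f g : Hom a b) :
  f ⊠ Id (munit C) = g ⊠ Id (munit C) -> f = g.
Proof.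
move=> E; apply: (is_iso_epi (runit_iso (smon_of C) a)).
by rewrite -!runit_natural E.
Qed.

(** Kelly's observation: whiskered with the unit, this triangle becomes a part
    of the pentagon for [munit C, munit C, a, b] whose other parts are
    instances of [triangle] and of naturality. *)
Lemma lunit_tens a b : λ_ (a ⊗ b) ∘ α (munit C) a b = λ_ a ⊠ Id b.
Proof.
set u := munit C.
apply: tensm_unitl_inj.
apply: (is_iso_epi (e := α u (u ⊗ a) b ∘ (α u u a ⊠ Id b))).
  apply: is_iso_comp; first exact: assoc_iso.
  by apply: is_iso_tensm; [exact: assoc_iso | exact: is_iso_id].
transitivity (α u a b ∘ ((ρ_ u ⊠ Id a) ⊠ Id b)).
  rewrite -(comp_idl (Id u)) tensm_comp -!compA (compA (Id u ⊠ α _ _ _)).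
  by rewrite -pentagon (comp_triangle (triangle _ _ _)) -tensm_id assoc_natural.
rewrite (comp_square (esym (assoc_natural _ _ _ _))) -tensm_comp triangle.
by rewrite comp_idl.
Qed.

(** The mirror image of the previous argument, with the pentagon for
    [a, b, munit C, munit C]. *)
Lemma runit_tens a b : (Id a ⊠ ρ_ b) ∘ α a b (munit C) = ρ_ (a ⊗ b).
Proof.
set u := munit C.
apply: tensm_unitr_inj.
apply: (is_iso_mono (assoc_iso (smon_of C) a b u)).
rewrite -(comp_idl (Id u)) tensm_comp (comp_square (assoc_natural _ _ _ _)).
rewrite -(triangle _ b) -{1}(comp_idl (Id a)) tensm_comp -!compA.
rewrite (compA (Id a ⊠ α _ _ _)) -pentagon.
rewrite (comp_square (esym (assoc_natural _ _ _ _))) tensm_id triangle.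
by rewrite comp_idl.
Qed.

(** The left unitor at [munit C ⊗ munit C] can be computed by naturality or by
    [lunit_tens]; comparing the results with [triangle] relates the two
    unitors at the unit. *)
Lemma lunit_runit_unit : λ_ (munit C) = ρ_ (munit C).
Proof.
apply: tensm_unitr_inj; rewrite -lunit_tens -triangle; congr (_ ∘ _).
by apply: (is_iso_mono (lunit_iso (smon_of C) _)); rewrite lunit_natural.
Qed.

End UnitCoherence.

(** * Transport of a symmetric monoidal structure *)

Section Transport.
Variables (C : symmMonCat) (O : Type) (P : O -> C).
Variables (tO : O -> O -> O) (uO : O).
Variable phi : forall a b, Hom (P a ⊗ P b) (P (tO a b)).
Variable eta : Hom (munit C) (P uO).
Hypothesis phi_iso : forall a b, is_iso (phi a b).
Hypothesis eta_iso : is_iso eta.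

(** The full image of [P] with the objects of [O] as names of its objects. *)
Definition full_image : category O :=
  @Category O (fun a b => Hom (P a) (P b)) (fun a => Id (P a))
    (fun a b c g f => g ∘ f)
    (fun a b f => comp_idl f) (fun a b f => comp_idr f)
    (fun a b c d h g f => compA h g f).

Lemma phil_iso (a b c : O) : is_iso (phi (tO a b) c ∘ (phi a b ⊠ Id (P c))).
Proof.
apply: is_iso_comp (phi_iso _ _) _; apply: is_iso_tensm (phi_iso _ _) _.
exact: is_iso_id.
Qed.

Lemma phi_eta_iso (a : O) : is_iso (phi uO a ∘ (eta ⊠ Id (P a))).
Proof.
apply: is_iso_comp (phi_iso _ _) _; apply: is_iso_tensm eta_iso _.
exact: is_iso_id.
Qed.

Lemma phi_etar_iso (a : O) : is_iso (phi a uO ∘ (Id (P a) ⊠ eta)).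
Proof.
apply: is_iso_comp (phi_iso _ _) _; apply: is_iso_tensm _ eta_iso.
exact: is_iso_id.
Qed.

(** The operations are forced by the requirement that [phi] and [eta] make the
    inclusion of [full_image] in [C] a symmetric monoidal functor: the equations
    [ttensmE] to [tbraidE] below are the axioms of such a functor. Each axiom of
    the transported structure is tested after composing with [phi] and [eta],
    where these equations move [phi] through both sides until an axiom of [C] is
    left. *)
Definition ttensm (a b c d : O) (f : Hom (P a) (P b)) (g : Hom (P c) (P d)) :
    Hom (P (tO a c)) (P (tO b d)) :=
  descend (phi_iso a c) (phi b d ∘ (f ⊠ g)).

Definition tassoc (a b c : O) :
    Hom (P (tO (tO a b) c)) (P (tO a (tO b c))) :=
  descend (phil_iso a b c)
    (phi a (tO b c) ∘ ((Id (P a) ⊠ phi b c) ∘ α (P a) (P b) (P c))).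

Definition tlunit (a : O) : Hom (P (tO uO a)) (P a) :=
  descend (phi_eta_iso a) (λ_ (P a)).

Definition trunit (a : O) : Hom (P (tO a uO)) (P a) :=
  descend (phi_etar_iso a) (ρ_ (P a)).

Definition tbraid (a b : O) : Hom (P (tO a b)) (P (tO b a)) :=
  descend (phi_iso a b) (phi b a ∘ β (P a) (P b)).

Lemma ttensmE (a b c d : O) (f : Hom (P a) (P b)) (g : Hom (P c) (P d)) :
  ttensm f g ∘ phi a c = phi b d ∘ (f ⊠ g).
Proof. exact: descendK. Qed.

Lemma tassocE (a b c : O) :
  tassoc a b c ∘ (phi (tO a b) c ∘ (phi a b ⊠ Id (P c))) =
  phi a (tO b c) ∘ ((Id (P a) ⊠ phi b c) ∘ α (P a) (P b) (P c)).
Proof. exact: descendK. Qed.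

Lemma tlunitE (a : O) : tlunit a ∘ (phi uO a ∘ (eta ⊠ Id (P a))) = λ_ (P a).
Proof. exact: descendK. Qed.

Lemma trunitE (a : O) : trunit a ∘ (phi a uO ∘ (Id (P a) ⊠ eta)) = ρ_ (P a).
Proof. exact: descendK. Qed.

Lemma tbraidE (a b : O) : tbraid a b ∘ phi a b = phi b a ∘ β (P a) (P b).
Proof. exact: descendK. Qed.

Lemma tassocE_comp (a b c : O) z (t : Hom z ((P a ⊗ P b) ⊗ P c)) :
  tassoc a b c ∘ (phi (tO a b) c ∘ ((phi a b ⊠ Id (P c)) ∘ t)) =
  phi a (tO b c) ∘ ((Id (P a) ⊠ phi b c) ∘ (α (P a) (P b) (P c) ∘ t)).
Proof. by rewrite (compA (phi _ _)) compA tassocE -!compA. Qed.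

Lemma ttensm_id (a b : O) : ttensm (Id (P a)) (Id (P b)) = Id (P (tO a b)).
Proof.
apply: (is_iso_epi (phi_iso a b)).
by rewrite ttensmE tensm_id comp_idl comp_idr.
Qed.

Lemma ttensm_comp (a b c a' b' c' : O)
    (g : Hom (P b) (P c)) (f : Hom (P a) (P b))
    (g' : Hom (P b') (P c')) (f' : Hom (P a') (P b')) :
  ttensm (g ∘ f) (g' ∘ f') = ttensm g g' ∘ ttensm f f'.
Proof.
apply: (is_iso_epi (phi_iso a a')).
by rewrite -compA !ttensmE (comp_square (ttensmE _ _)) tensm_comp.
Qed.

Lemma tassoc_iso (a b c : O) : is_iso (tassoc a b c).
Proof.
apply: is_iso_descend; apply: is_iso_comp (phi_iso _ _) _.
apply: is_iso_comp _ (assoc_iso _ _ _ _); apply: is_iso_tensm _ (phi_iso _ _).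
exact: is_iso_id.
Qed.

Lemma tlunit_iso (a : O) : is_iso (tlunit a).
Proof. exact: is_iso_descend (lunit_iso _ _). Qed.

Lemma trunit_iso (a : O) : is_iso (trunit a).
Proof. exact: is_iso_descend (runit_iso _ _). Qed.

Lemma tassoc_natural (a b c a' b' c' : O) (f : Hom (P a) (P a'))
    (g : Hom (P b) (P b')) (h : Hom (P c) (P c')) :
  tassoc a' b' c' ∘ ttensm (ttensm f g) h =
  ttensm f (ttensm g h) ∘ tassoc a b c.
Proof.
apply: (is_iso_epi (phil_iso a b c)).
rewrite -!compA tassocE !(comp_square (ttensmE _ _)).
rewrite -tensm_comp ttensmE comp_idr -(comp_idl h) tensm_comp comp_idl.
rewrite tassocE_comp assoc_natural tensm_fuse.
by rewrite tensm_fuse ttensmE comp_idl comp_idr.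
Qed.

Lemma tlunit_natural (a b : O) (f : Hom (P a) (P b)) :
  tlunit b ∘ ttensm (Id (P uO)) f = f ∘ tlunit a.
Proof.
apply: (is_iso_epi (phi_eta_iso a)).
rewrite -!compA tlunitE (comp_square (ttensmE _ _)) -tensm_comp.
rewrite comp_idl comp_idr -(comp_idr eta) -(comp_idl f) tensm_comp.
by rewrite (compA (phi _ _)) compA tlunitE lunit_natural comp_idl.
Qed.

Lemma trunit_natural (a b : O) (f : Hom (P a) (P b)) :
  trunit b ∘ ttensm f (Id (P uO)) = f ∘ trunit a.
Proof.
apply: (is_iso_epi (phi_etar_iso a)).
rewrite -!compA trunitE (comp_square (ttensmE _ _)) -tensm_comp.
rewrite comp_idl comp_idr -(comp_idr eta) -(comp_idl f) tensm_comp.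
by rewrite (compA (phi _ _)) compA trunitE runit_natural comp_idl.
Qed.

Lemma tbraid_natural (a b a' b' : O)
    (f : Hom (P a) (P a')) (g : Hom (P b) (P b')) :
  tbraid a' b' ∘ ttensm f g = ttensm g f ∘ tbraid a b.
Proof.
apply: (is_iso_epi (phi_iso a b)).
rewrite -!compA ttensmE tbraidE (comp_square (tbraidE _ _)).
by rewrite (comp_square (ttensmE _ _)) braid_natural.
Qed.

Lemma tpentagon (a b c d : O) :
  tassoc a b (tO c d) ∘ tassoc (tO a b) c d =
  ttensm (Id (P a)) (tassoc b c d) ∘ tassoc a (tO b c) d
    ∘ ttensm (tassoc a b c) (Id (P d)).
Proof.
apply: (is_iso_epi (phil_iso (tO a b) c d)).
apply: (is_iso_epi (e := (phi a b ⊠ Id (P c)) ⊠ Id (P d))).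
  by apply: is_iso_tensm (is_iso_id _ _);
     apply: is_iso_tensm (phi_iso _ _) (is_iso_id _ _).
(* Both sides push [phi] through to the same arrow, up to the pentagon of [C]. *)
transitivity (phi a (tO b (tO c d)) ∘ ((Id (P a) ⊠ phi b (tO c d))
    ∘ ((Id (P a) ⊠ (Id (P b) ⊠ phi c d))
    ∘ (α (P a) (P b) (P c ⊗ P d) ∘ α (P a ⊗ P b) (P c) (P d))))).
  rewrite -!compA tassocE_comp assoc_natural tensm_id.
  rewrite tensm_fuse comp_idl comp_idr.
  rewrite -{1}(comp_idr (phi a b)) -{1}(comp_idl (phi c d)) tensm_comp.
  rewrite -!compA tassocE_comp -(tensm_id _ (P a)).
  by rewrite (comp_square (assoc_natural _ _ _ _)).
rewrite pentagon -!compA (comp_square (ttensmE _ _)).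
rewrite -!tensm_compl -?compA tassocE !tensm_compl tassocE_comp.
rewrite (comp_square (assoc_natural _ _ _ _)) (comp_square (ttensmE _ _)).
by rewrite !tensm_fuse !comp_idl -(compA (tassoc _ _ _)) tassocE !compA.
Qed.

Lemma ttriangle (a b : O) :
  ttensm (Id (P a)) (tlunit b) ∘ tassoc a uO b = ttensm (trunit a) (Id (P b)).
Proof.
apply: (is_iso_epi (phil_iso a uO b)).
apply: (is_iso_epi (e := (Id (P a) ⊠ eta) ⊠ Id (P b))).
  by apply: is_iso_tensm (is_iso_id _ _);
     apply: is_iso_tensm (is_iso_id _ _) eta_iso.
rewrite -!compA tassocE_comp assoc_natural.
rewrite !(comp_square (ttensmE _ _)) -!tensm_compl -?compA trunitE.
by rewrite !tensm_fuse !comp_idl -compA tlunitE triangle.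
Qed.

Lemma thexagon (a b c : O) :
  tassoc b c a ∘ tbraid a (tO b c) ∘ tassoc a b c =
  ttensm (Id (P b)) (tbraid a c) ∘ tassoc b a c
    ∘ ttensm (tbraid a b) (Id (P c)).
Proof.
apply: (is_iso_epi (phil_iso a b c)).
rewrite -!compA tassocE (comp_square (tbraidE _ _)).
rewrite (comp_square (braid_natural _ _ _)) tassocE_comp.
rewrite (compA (α _ _ _)) hexagon.
rewrite (comp_square (ttensmE _ _)) -tensm_compl tbraidE tensm_compl.
rewrite tassocE_comp (comp_square (ttensmE _ _)) tensm_fuse comp_idl tbraidE.
by rewrite tensm_compr -!compA.
Qed.

Lemma tbraidK (a b : O) : tbraid b a ∘ tbraid a b = Id (P (tO a b)).
Proof.
apply: (is_iso_epi (phi_iso a b)).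
by rewrite -compA tbraidE (comp_square (tbraidE _ _)) braidK comp_idl comp_idr.
Qed.

Definition transported : symmetric_monoidal full_image :=
  @SymmetricMonoidal O full_image tO ttensm ttensm_id ttensm_comp uO
    tassoc tlunit trunit tbraid tassoc_iso tlunit_iso trunit_iso
    tassoc_natural tlunit_natural trunit_natural tbraid_natural
    tpentagon ttriangle thexagon tbraidK.

#[local] Obligation Tactic := intros; simpl.

Program Definition transported_incl :
    symmMonFunctor (SymmMonCat transported) C :=
  {| fobj := P : SymmMonCat transported -> C;
     fmap := fun a b f => f;
     fmu := phi;
     feta := eta |}.
Next Obligation. by []. Qed.
Next Obligation. by []. Qed.
Next Obligation. exact: phi_iso. Qed.
Next Obligation. exact: eta_iso. Qed.
Next Obligation. exact: (esym (ttensmE _ _)). Qed.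
Next Obligation. by rewrite -!compA; exact: tassocE. Qed.
Next Obligation. by rewrite -compA; exact: tlunitE. Qed.
Next Obligation. by rewrite -compA; exact: trunitE. Qed.
Next Obligation. exact: tbraidE. Qed.

End Transport.

(** * Tensor powers *)

Section Powers.
Variables (C : symmMonCat) (x : C).

(** Unlike [tpow], this recursion does not single out [n = 1]; hence
    [upow (S m + n)] is convertible to [x ⊗ upow (m + n)] for all [m] and [n],
    which makes [upowD] below definable by a plain recursion. *)
Fixpoint upow (n : nat) : C :=
  match n with
  | 0 => munit C
  | S m => x ⊗ upow m
  end.

Lemma upow_tpow (n : nat) : isomorphic (cat_of C) (upow n) (tpow x n).
Proof.
elim: n => [|[|n] IHn]; first exact: eq_isomorphic.
  by exists (ρ_ x); exact: runit_iso.
exact: isomorphic_tens (eq_isomorphic _ erefl) IHn.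
Qed.

Fixpoint upowD (m n : nat) : Hom (upow m ⊗ upow n) (upow (m + n)) :=
  match m with
  | 0 => λ_ (upow n)
  | S m' => (Id x ⊠ upowD m' n) ∘ α x (upow m') (upow n)
  end.

Lemma upowD_iso (m n : nat) : is_iso (upowD m n).
Proof.
elim: m => [|m IHm] /=; first exact: lunit_iso.
by apply: is_iso_comp (assoc_iso _ _ _ _); exact: is_iso_tensm (is_iso_id _ _) _.
Qed.

Notation upow_cat := (full_image upow).

(** Strictness involves identities along equations such as
    [m + n + p = m + (n + p)] that do not hold by computation; in the inductions
    below they are produced one factor [x] at a time. *)
Lemma tensm_eq_hom_upow (m n : nat) (e : m = n) :
  Id x ⊠ (eq_hom upow_cat e : Hom (upow m) (upow n)) =
  eq_hom upow_cat (f_equal S e).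
Proof. by case: n / e => /=; rewrite tensm_id. Qed.

(** The powers add up associatively. A factor [x] on the left is moved past the
    inductive hypothesis by the pentagon, and for [m = 0] the equation is
    [lunit_tens] up to naturality. *)
Lemma upowD_assoc (m n p : nat) :
  exists e : m + n + p = m + (n + p),
    (eq_hom upow_cat e : Hom (upow (m + n + p)) (upow (m + (n + p))))
      ∘ (upowD (m + n) p ∘ (upowD m n ⊠ Id (upow p))) =
    upowD m (n + p) ∘ ((Id (upow m) ⊠ upowD n p) ∘ α _ _ _).
Proof.
elim: m => [|m [e IHm]].
  exists erefl => /=.
  by rewrite comp_idl compA lunit_natural -compA lunit_tens.
exists (f_equal S e); rewrite -tensm_eq_hom_upow /=.
rewrite tensm_compl -!compA (comp_square (assoc_natural _ _ _ _)).
rewrite -(tensm_id _ x) (comp_square (assoc_natural _ _ _ _)) pentagon -!compA.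
by rewrite !tensm_fuse !comp_idl -!compA IHm.
Qed.

Lemma upowD_runit (m : nat) :
  exists e : m + 0 = m,
    (eq_hom upow_cat e : Hom (upow (m + 0)) (upow m)) ∘ upowD m 0 = ρ_ (upow m).
Proof.
elim: m => [|m [e IHm]].
  by exists erefl; rewrite /= comp_idl lunit_runit_unit.
exists (f_equal S e); rewrite -tensm_eq_hom_upow /=.
by rewrite tensm_fuse comp_idl IHm runit_tens.
Qed.

Definition upow_symmMonCat : symmMonCat :=
  SymmMonCat (transported upowD_iso (is_iso_id _ (upow 0))).

(** [upowD_assoc], [upowD_runit] and the computation rules of [upowD] say that
    the canonical arrows satisfy the equations which characterise the
    transported associator and unitors. *)
Lemma upow_strict : strict upow_symmMonCat.
Proof.
split; [|split] => [m n p|n|n] /=.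
- have [e E] := upowD_assoc m n p; exists e.
  by apply: (is_iso_epi (phil_iso upowD_iso m n p)); rewrite E; exact: tassocE.
- exists erefl.
  apply: (is_iso_epi (phi_eta_iso upowD_iso (is_iso_id _ (upow 0)) n)).
  by rewrite tlunitE /= tensm_id comp_idl comp_idr.
- have [e E] := upowD_runit n; exists e.
  apply: (is_iso_epi (phi_etar_iso upowD_iso (is_iso_id _ (upow 0)) n)).
  by rewrite trunitE tensm_id comp_idr E.
Qed.

Definition upow_prop : prop :=
  MkProp upow_strict (fun m n => erefl (m + n)).

Definition upow_incl : symmMonFunctor upow_prop C :=
  transported_incl upowD_iso (is_iso_id _ (upow 0)).

End Powers.

(** * Inverting a fully faithful, essentially surjective functor *)

Section WeakInverse.
Variables (C D : symmMonCat) (F : symmMonFunctor D C).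
Hypothesis F_faithful : forall (a b : D) (f g : Hom a b),
  fmap F f = fmap F g -> f = g.
Hypothesis F_full : forall (a b : D) (g : Hom (F a) (F b)),
  exists f : Hom a b, fmap F f = g.
Hypothesis F_esurj : forall c : C, exists d : D, isomorphic (cat_of C) (F d) c.

Definition lift (a b : D) (g : Hom (F a) (F b)) : Hom a b :=
  proj1_sig (constructive_indefinite_description _ (F_full g)).

Lemma fmap_lift (a b : D) (g : Hom (F a) (F b)) : fmap F (lift g) = g.
Proof. by rewrite /lift; case: constructive_indefinite_description. Qed.

Lemma is_iso_reflect (a b : D) (f : Hom a b) : is_iso (fmap F f) -> is_iso f.
Proof.
move=> [g [fK Kf]]; exists (lift g); split; apply: F_faithful;
by rewrite fmap_comp fmap_lift fmap_id.
Qed.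

Definition wobj (c : C) : D :=
  proj1_sig (constructive_indefinite_description _ (F_esurj c)).

Lemma wobj_isomorphic (c : C) : isomorphic (cat_of C) (F (wobj c)) c.
Proof. by rewrite /wobj; case: constructive_indefinite_description. Qed.

Definition wcounit (c : C) : Hom (F (wobj c)) c :=
  proj1_sig (constructive_indefinite_description _ (wobj_isomorphic c)).

Lemma wcounit_iso (c : C) : is_iso (wcounit c).
Proof. by rewrite /wcounit; case: constructive_indefinite_description. Qed.

(** With [transpose_inj] this is the universal property that makes [wobj] a
    right adjoint of [F]; fullness is combined with the invertibility of
    [wcounit]. *)
Lemma wcounit_lift (a : D) (c : C) (g : Hom (F a) c) :
  exists f : Hom a (wobj c), wcounit c ∘ fmap F f = g.
Proof.
have [v [uK Ku]] := wcounit_iso c.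
by exists (lift (v ∘ g)); rewrite fmap_lift compA Ku comp_idl.
Qed.

Definition transpose (a : D) (c : C) (g : Hom (F a) c) : Hom a (wobj c) :=
  proj1_sig (constructive_indefinite_description _ (wcounit_lift g)).

Lemma transposeK (a : D) (c : C) (g : Hom (F a) c) :
  wcounit c ∘ fmap F (transpose g) = g.
Proof. by rewrite /transpose; case: constructive_indefinite_description. Qed.

Lemma transpose_inj (a : D) (c : C) (f g : Hom a (wobj c)) :
  wcounit c ∘ fmap F f = wcounit c ∘ fmap F g -> f = g.
Proof. by move=> E; apply: F_faithful; exact: is_iso_mono (wcounit_iso c) _. Qed.

Lemma is_iso_transpose (a : D) (c : C) (g : Hom (F a) c) :
  is_iso g -> is_iso (transpose g).
Proof.
move=> [h [gK Kg]]; apply: is_iso_reflect.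
exists (h ∘ wcounit c); split; first by rewrite -compA transposeK.
apply: (is_iso_mono (wcounit_iso c)).
by rewrite !compA transposeK Kg comp_idl comp_idr.
Qed.

(** The inverse functor is determined by the demand that [wcounit] be a
    monoidal natural isomorphism: [wmapE], [wmuE] and [wetaE] state this demand,
    and each axiom below follows from them once it is mapped to [C] by [F] and
    composed with [wcounit] and the structure isomorphisms of [F]. *)
Definition wmap (a b : C) (f : Hom a b) : Hom (wobj a) (wobj b) :=
  transpose (f ∘ wcounit a).

Definition wmu (a b : C) : Hom (wobj a ⊗ wobj b) (wobj (a ⊗ b)) :=
  transpose (descend (fmu_iso F (wobj a) (wobj b)) (wcounit a ⊠ wcounit b)).

Definition weta : Hom (munit D) (wobj (munit C)) :=
  transpose (descend (feta_iso F) (Id (munit C))).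

Lemma wmapE (a b : C) (f : Hom a b) :
  wcounit b ∘ fmap F (wmap f) = f ∘ wcounit a.
Proof. exact: transposeK. Qed.

Lemma wmuE (a b : C) :
  wcounit (a ⊗ b) ∘ (fmap F (wmu a b) ∘ fmu F (wobj a) (wobj b)) =
  wcounit a ⊠ wcounit b.
Proof. by rewrite compA transposeK descendK. Qed.

Lemma wetaE : wcounit (munit C) ∘ (fmap F weta ∘ feta F) = Id (munit C).
Proof. by rewrite compA transposeK descendK. Qed.

Lemma wmu_iso (a b : C) : is_iso (wmu a b).
Proof.
apply: is_iso_transpose; apply: is_iso_descend.
exact: is_iso_tensm (wcounit_iso _) (wcounit_iso _).
Qed.

Lemma weta_iso : is_iso weta.
Proof. by apply: is_iso_transpose; apply: is_iso_descend; exact: is_iso_id. Qed.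

Lemma wmap_id (a : C) : wmap (Id a) = Id (wobj a).
Proof. by apply: transpose_inj; rewrite wmapE fmap_id comp_idl comp_idr. Qed.

Lemma wmap_comp (a b c : C) (g : Hom b c) (f : Hom a b) :
  wmap (g ∘ f) = wmap g ∘ wmap f.
Proof.
apply: transpose_inj.
by rewrite fmap_comp (comp_square (wmapE _)) !wmapE -compA.
Qed.

Lemma wmuE_comp (a b : C) z (t : Hom z (F (wobj a) ⊗ F (wobj b))) :
  wcounit (a ⊗ b) ∘ (fmap F (wmu a b) ∘ (fmu F (wobj a) (wobj b) ∘ t)) =
  (wcounit a ⊠ wcounit b) ∘ t.
Proof. by rewrite (compA (fmap F _)) compA wmuE. Qed.

Lemma fmu_naturall (a b c : D) (f : Hom a b) :
  fmap F (f ⊠ Id c) ∘ fmu F a c = fmu F b c ∘ (fmap F f ⊠ Id (F c)).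
Proof. by rewrite -fmu_natural fmap_id. Qed.

Lemma fmu_naturalr (a b c : D) (f : Hom a b) :
  fmap F (Id c ⊠ f) ∘ fmu F c a = fmu F c b ∘ (Id (F c) ⊠ fmap F f).
Proof. by rewrite -fmu_natural fmap_id. Qed.

Lemma wmu_natural (a b a' b' : C) (f : Hom a a') (g : Hom b b') :
  wmu a' b' ∘ (wmap f ⊠ wmap g) = wmap (f ⊠ g) ∘ wmu a b.
Proof.
apply: transpose_inj; apply: (is_iso_epi (fmu_iso F _ _)).
rewrite !fmap_comp -!compA -fmu_natural wmuE_comp.
rewrite (comp_square (wmapE _)) wmuE.
by rewrite -!tensm_comp !wmapE.
Qed.

Lemma wmu_assoc (a b c : C) :
  wmap (α a b c) ∘ wmu (a ⊗ b) c ∘ (wmu a b ⊠ Id (wobj c)) =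
  wmu a (b ⊗ c) ∘ (Id (wobj a) ⊠ wmu b c) ∘ α (wobj a) (wobj b) (wobj c).
Proof.
apply: transpose_inj; apply: (is_iso_epi (fmu_iso F _ _)).
apply: (is_iso_epi (e := fmu F (wobj a) (wobj b) ⊠ Id (F (wobj c)))).
  exact: is_iso_tensm (fmu_iso _ _ _) (is_iso_id _ _).
rewrite !fmap_comp -!compA (comp_square (wmapE _)).
rewrite (comp_square (fmu_naturall _ _)) wmuE_comp !tensm_fuse.
rewrite -tensm_comp !comp_idr -!compA wmuE.
rewrite (compA (fmap F (α _ _ _))) fmu_assoc.
rewrite -!compA (comp_square (fmu_naturalr _ _)) wmuE_comp.
by rewrite !tensm_fuse !comp_idr -!compA wmuE assoc_natural.
Qed.

Lemma wmu_lunit (a : C) :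
  wmap (λ_ a) ∘ wmu (munit C) a ∘ (weta ⊠ Id (wobj a)) = λ_ (wobj a).
Proof.
apply: transpose_inj; apply: (is_iso_epi (fmu_iso F _ _)).
apply: (is_iso_epi (e := feta F ⊠ Id (F (wobj a)))).
  exact: is_iso_tensm (feta_iso _) (is_iso_id _ _).
rewrite !fmap_comp -!compA (comp_square (wmapE _)).
rewrite (comp_square (fmu_naturall _ _)) wmuE_comp !tensm_fuse.
rewrite -tensm_comp !comp_idr -!compA wetaE lunit_natural.
by rewrite (compA (fmap F _)) fmu_lunit.
Qed.

Lemma wmu_runit (a : C) :
  wmap (ρ_ a) ∘ wmu a (munit C) ∘ (Id (wobj a) ⊠ weta) = ρ_ (wobj a).
Proof.
apply: transpose_inj; apply: (is_iso_epi (fmu_iso F _ _)).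
apply: (is_iso_epi (e := Id (F (wobj a)) ⊠ feta F)).
  exact: is_iso_tensm (is_iso_id _ _) (feta_iso _).
rewrite !fmap_comp -!compA (comp_square (wmapE _)).
rewrite (comp_square (fmu_naturalr _ _)) wmuE_comp !tensm_fuse.
rewrite -tensm_comp !comp_idr -!compA wetaE runit_natural.
by rewrite (compA (fmap F _)) fmu_runit.
Qed.

Lemma wmu_braid (a b : C) :
  wmap (β a b) ∘ wmu a b = wmu b a ∘ β (wobj a) (wobj b).
Proof.
apply: transpose_inj; apply: (is_iso_epi (fmu_iso F _ _)).
rewrite !fmap_comp -!compA (comp_square (wmapE _)) wmuE fmu_braid wmuE_comp.
exact: braid_natural.
Qed.

Definition weak_inverse : symmMonFunctor C D :=
  @SymmMonFunctor C D wobj wmap wmap_id wmap_comp wmu weta wmu_iso weta_iso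
    wmu_natural wmu_assoc wmu_lunit wmu_runit wmu_braid.

Lemma weak_inverse_counit :
  monoidally_isomorphic (functor_comp F weak_inverse) (functor_id C).
Proof.
unshelve refine (ex_intro _ (@MonoidalNatTrans _ _
  (functor_comp F weak_inverse) (functor_id C) wcounit _ _ _) _) => /=.
- exact: wmapE.
- by move=> a b; rewrite wmuE comp_idl.
- exact: wetaE.
- exact: wcounit_iso.
Qed.

Lemma weak_inverse_unit :
  monoidally_isomorphic (functor_comp weak_inverse F) (functor_id D).
Proof.
unshelve refine (ex_intro _ (@MonoidalNatTrans _ _
  (functor_comp weak_inverse F) (functor_id D)
  (fun d => lift (wcounit (F d))) _ _ _) _) => /= [a b f|a b||a].
- by apply: F_faithful; rewrite !fmap_comp !fmap_lift; exact: wmapE.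
- apply: F_faithful; apply: (is_iso_epi (fmu_iso F _ _)).
  rewrite !fmap_comp !fmap_lift (compA (wcounit _)) wmapE -!compA wmuE.
  by rewrite fmap_id comp_idl -fmu_natural !fmap_lift.
- apply: F_faithful; apply: (is_iso_epi (feta_iso F)).
  rewrite !fmap_comp !fmap_lift (compA (wcounit _)) wmapE -!compA wetaE.
  by rewrite fmap_id comp_idl comp_idr.
- by apply: is_iso_reflect; rewrite fmap_lift; exact: wcounit_iso.
Qed.

(** One of the two isomorphisms is [wcounit]; the other is its restriction to
    the objects [F d], lifted along [F]. *)
Theorem equivalence_of_ff_esurj : symmMon_equivalent C D.
Proof.
exists F, weak_inverse.
by split; [exact: weak_inverse_counit | exact: weak_inverse_unit].
Qed.

End WeakInverse.

(** * Equivalence with a prop *)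

Lemma fobj_tpow (C D : symmMonCat) (F : symmMonFunctor C D) (x : C) (n : nat) :
  isomorphic (cat_of D) (F (tpow x n)) (tpow (F x) n).
Proof.
elim: n => [|[|n] IHn].
- by apply: isomorphic_sym; exists (feta F); exact: feta_iso.
- exact: eq_isomorphic.
- apply: isomorphic_trans (isomorphic_tens (eq_isomorphic _ erefl) IHn).
  by apply: isomorphic_sym; exists (fmu F x (tpow x (S n))); exact: fmu_iso.
Qed.

(** Strictness makes the unit object neutral for addition. *)
Lemma prop_munit (T : prop) : munit T = 0.
Proof.
have [_ [/(_ 0) [e _] _]] := prop_strict T.
have := prop_tens T (munit T) 0; rewrite /= in e *; lia.
Qed.

Lemma tpow_prop (T : prop) (n : nat) : tpow (C := T) 1 n = n.
Proof.
elim: n => [|[|n] IHn] //; first exact: prop_munit.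
transitivity (1 + tpow (C := T) 1 (S n)); first exact: prop_tens.
by rewrite IHn.
Qed.

Theorem proposition4p3 (C : symmMonCat) :
  (exists T : prop, symmMon_equivalent C T) <->
  (exists x : C, forall c : C, exists n : nat,
     isomorphic (cat_of C) c (tpow x n)).
Proof.
split=> [[T [j [k [[theta theta_iso] _]]]]|[x x_gen]].
- exists (j 1) => c; exists (k c).
  apply: isomorphic_trans (fobj_tpow j 1 (k c)); rewrite tpow_prop.
  by apply: isomorphic_sym; exists (theta c); exact: theta_iso.
- exists (upow_prop x); apply: (equivalence_of_ff_esurj (F := upow_incl x)).
  + by [].
  + by move=> a b g; exists g.
  + move=> c; have [n c_iso] := x_gen c; exists n.
    exact: isomorphic_trans (upow_tpow x n) (isomorphic_sym c_iso).
Qed.
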